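(* Let $ABC$ be a triangle with circumcircle $\omega$, circumcenter $O$ and Lemoine (symmedian) point $L$. Let $A', B', C'$ denote the intersections of the lines $AL, BL, CL$ with the circumcircle $\omega$ (distinct from $A, B, C$ respectively). The circle $\omega_1$, passing through points $A'$ and $L$ and tangent to $\omega$ at $A'$, intersects the line $BC$ at points $A_b$ and $A_c$. The circle $\omega_2$, passing through points $B'$ and $L$ and tangent to $\omega$ at $B'$, intersects the line $CA$ at points $B_c$ and $B_a$. The circle $\omega_3$, passing through points $C'$ and $L$ and tangent to $\omega$ at $C'$, intersects the line $AB$ at points $C_a$ and $C_b$. Then the points $A_b, A_c, B_a, B_c, C_a, C_b$ lie on a single circle. This circle is not a Tucker circle of triangle $ABC$, and its center $M$ lies on the line $OL$ and satisfies $LM = \frac{3}{4}\cdot LO$ (where the segments are directed).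
   Context: The Lemoine point (symmedian point) $L$ of a triangle is the common point of its three symmedians, a symmedian being the reflection of a median across the internal angle bisector from the same vertex. A line $k$ is antiparallel to a line $l$ with respect to an angle $\angle XYZ$ if the reflection of $k$ across the bisector of $\angle XYZ$ is parallel to $l$. Below, ''antiparallel to a side'' of triangle $ABC$ means antiparallel with respect to the angle of the triangle opposite that side. Tucker circle: let $T_1$ be a point on the line $AB$, distinct from $A$ and $B$. Let the line through $T_1$ antiparallel to $BC$ meet the line $AC$ at $T_2$; let the line through $T_2$ parallel to $AB$ meet the line $BC$ at $T_3$; let the line through $T_3$ antiparallel to $AC$ meet the line $AB$ at $T_4$; let the line through $T_4$ parallel to $BC$ meet the line $CA$ at $T_5$; let the line through $T_5$ antiparallel to $AB$ meet the line $BC$ at $T_6$. Then the line through $T_6$ parallel to $AC$ meets $AB$ at $T_1$, and the points $T_1,\dots,T_6$ form a (Tucker) hexagon whose sides are alternately parallel and antiparallel to the sides of triangle $ABC$. The six vertices of a Tucker hexagon lie on a single circle; a circle arising in this way (for some choice of $T_1$) is called a Tucker circle of triangle $ABC$.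
   Formalization: That the circle is not a Tucker circle is claimed only when O and L are distinct, i.e. ABC is not equilateral; for an equilateral triangle O = L, the line OL is undefined, and the circle is in fact a Tucker circle. *)

(* Defs.v *)
From Stdlib Require Export Reals.
Open Scope R_scope.

Definition point : Type := (R * R)%type.

Definition vadd (u v : point) : point := (fst u + fst v, snd u + snd v).
Definition vec (P Q : point) : point := (fst Q - fst P, snd Q - snd P).
Definition vscale (a : R) (u : point) : point := (a * fst u, a * snd u).
Definition dot (u v : point) : R := fst u * fst v + snd u * snd v.
Definition cross (u v : point) : R := fst u * snd v - snd u * fst v.
Definition edist (P Q : point) : R := dist_euc (fst P) (snd P) (fst Q) (snd Q).
Definition midpoint (P Q : point) : point := vadd P (vscale (1 / 2) (vec P Q)).

(* The line {base + t dir}.  [dir] is not forced to be nonzero; when it is zero,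
   [on_line] below holds of every point. *)
Record line : Type := Line { base : point; dir : point }.

Definition line_through (P Q : point) : line := Line P (vec P Q).
Definition on_line (P : point) (l : line) : Prop :=
  cross (vec (base l) P) (dir l) = 0.

(* A line counts as parallel to itself; degenerate lines are parallel to nothing. *)
Definition parallel (k l : line) : Prop :=
  dir k <> (0, 0) /\ dir l <> (0, 0) /\ cross (dir k) (dir l) = 0.

Definition is_triangle (A B C : point) : Prop := ~ on_line C (line_through A B).

Definition reflect_point (m : line) (P : point) : point :=
  let d := dir m in
  let v := vec (base m) P in
  vadd (base m) (vec v (vscale (2 * (dot v d / dot d d)) d)).

Definition reflect_line (m k : line) : line :=
  line_through (reflect_point m (base k)) (reflect_point m (vadd (base k) (dir k))).

Definition unit_vec (P Q : point) : point := vscale (/ edist P Q) (vec P Q).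

(* Internal bisector of the angle XYZ, with vertex Y. *)
Definition bisector (X Y Z : point) : line :=
  Line Y (vadd (unit_vec Y X) (unit_vec Y Z)).

(* The symmedian from the first vertex A. *)
Definition symmedian (A B C : point) : line :=
  reflect_line (bisector B A C) (line_through A (midpoint B C)).

Definition lemoine_point (A B C L : point) : Prop :=
  on_line L (symmedian A B C) /\
  on_line L (symmedian B C A) /\
  on_line L (symmedian C A B).

Record circle : Type :=
  Circle { center : point; radius : R; radius_gt0 : 0 < radius }.

Definition on_circle (P : point) (w : circle) : Prop :=
  edist P (center w) = radius w.

Definition circumcircle (A B C : point) (w : circle) : Prop :=
  on_circle A w /\ on_circle B w /\ on_circle C w.

Definition tangent_at (w1 w2 : circle) (P : point) : Prop :=
  forall Q : point, (on_circle Q w1 /\ on_circle Q w2) <-> Q = P.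

(* The intersection of w and l is exactly {P, Q}. *)
Definition meets_line_at (w : circle) (l : line) (P Q : point) : Prop :=
  forall S : point, (on_circle S w /\ on_line S l) <-> (S = P \/ S = Q).

Definition antiparallel (k l : line) (X Y Z : point) : Prop :=
  parallel (reflect_line (bisector X Y Z) k) l.

(* P and Q are not required to be distinct: in a Tucker hexagon T2 = T3 = C can
   occur, for instance. *)
Definition on_parallel (P Q : point) (l : line) : Prop :=
  exists k : line, parallel k l /\ on_line P k /\ on_line Q k.

Definition on_antiparallel (P Q : point) (l : line) (X Y Z : point) : Prop :=
  exists k : line, antiparallel k l X Y Z /\ on_line P k /\ on_line Q k.

(* The closing condition, T6T1 parallel to AC, is a consequence and is not
   imposed. *)
Definition tucker_hexagon (A B C T1 T2 T3 T4 T5 T6 : point) : Prop :=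
  let AB := line_through A B in
  let BC := line_through B C in
  let CA := line_through C A in
  (on_line T1 AB /\ T1 <> A /\ T1 <> B) /\
  (on_antiparallel T1 T2 BC B A C /\ on_line T2 CA) /\
  (on_parallel T2 T3 AB /\ on_line T3 BC) /\
  (on_antiparallel T3 T4 CA A B C /\ on_line T4 AB) /\
  (on_parallel T4 T5 BC /\ on_line T5 CA) /\
  (on_antiparallel T5 T6 AB A C B /\ on_line T6 BC).

Definition tucker_circle (A B C : point) (w : circle) : Prop :=
  exists T1 T2 T3 T4 T5 T6 : point,
    tucker_hexagon A B C T1 T2 T3 T4 T5 T6 /\
    on_circle T1 w /\ on_circle T2 w /\ on_circle T3 w /\
    on_circle T4 w /\ on_circle T5 w /\ on_circle T6 w.

(* Main.v *)
(* Write a, b, c for the sides and S = a^2 + b^2 + c^2.  The Lemoine point is the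
   barycenter of A, B, C with weights a^2, b^2, c^2, so Lagrange's formula gives
   its distance to every point, and Stewart's theorem then gives the power of
   any point of the figure.  With respect to w1 the powers of B and C are
   c^2 a^2 / (2S) and a^2 b^2 / (2S).  The circle W centered at
   M = L + 3/4 (O - L) for which A, B, C have powers b^2 c^2 / (2S),
   c^2 a^2 / (2S), a^2 b^2 / (2S) therefore agrees with w1 on BC, and likewise
   with w2 on CA and with w3 on AB.  If W were a Tucker circle, comparing the
   powers of the vertices T2, T3 and of T4, T5 would force a = b = c, and then
   O = L. *)

Require Import Defs.
From Stdlib Require Import Reals.
From Stdlib Require Import Lra.
Open Scope R_scope.

(** * Squared distances, lines and circles in coordinates *)

Definition sqd (P Q : point) : R := dot (vec P Q) (vec P Q).

Definition lerp (s : R) (P Q : point) : point := vadd P (vscale s (vec P Q)).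

Ltac coords :=
  unfold lerp, sqd, is_triangle, on_line, line_through, midpoint, dot, cross,
    vec, vadd, vscale in *; cbn [fst snd base dir] in *.

Lemma sqd_sym (P Q : point) : sqd P Q = sqd Q P.
Proof. coords; ring. Qed.

Lemma sqd_ge0 (P Q : point) : 0 <= sqd P Q.
Proof. coords; apply Rplus_le_le_0_compat; apply Rle_0_sqr. Qed.

Lemma sqd_eq0 (P Q : point) : sqd P Q = 0 -> P = Q.
Proof.
intro h; destruct (Rplus_sqr_eq_0 _ _ h) as [h1 h2].
destruct P, Q; coords; f_equal; lra.
Qed.

Lemma sqd_gt0 (P Q : point) : P <> Q -> 0 < sqd P Q.
Proof.
intro ne; destruct (sqd_ge0 P Q) as [h | h]; [exact h | exfalso; apply ne].
now apply sqd_eq0.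
Qed.

Lemma edist_sqr (P Q : point) : edist P Q * edist P Q = sqd P Q.
Proof.
unfold edist, dist_euc; rewrite sqrt_sqrt.
- coords; unfold Rsqr; ring.
- apply Rplus_le_le_0_compat; apply Rle_0_sqr.
Qed.

Lemma edist_gt0 (P Q : point) : P <> Q -> 0 < edist P Q.
Proof.
intro ne; pose proof (sqd_gt0 P Q ne) as h; rewrite <- edist_sqr in h.
assert (0 <= edist P Q) by apply sqrt_pos; nra.
Qed.

Lemma on_circleE (P : point) (w : circle) :
  on_circle P w <-> sqd P (center w) = radius w * radius w.
Proof.
unfold on_circle; rewrite <- edist_sqr; pose proof (radius_gt0 w).
assert (0 <= edist P (center w)) by apply sqrt_pos.
split; [intros ->; reflexivity | nra].
Qed.

Lemma triangle_rot (A B C : point) : is_triangle A B C -> is_triangle B C A.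
Proof. intros h e; apply h; coords; lra. Qed.

Lemma triangle_neq (A B C : point) : is_triangle A B C -> A <> B.
Proof. intros h ->; apply h; coords; ring. Qed.

Lemma lerp_sym (s : R) (P Q : point) : lerp s P Q = lerp (1 - s) Q P.
Proof. coords; f_equal; ring. Qed.

Lemma on_lineE (P X Y : point) :
  X <> Y -> on_line P (line_through X Y) -> exists s, P = lerp s X Y.
Proof.
intros ne h; apply sqd_gt0 in ne.
exists (dot (vec X P) (vec X Y) / sqd X Y).
(* The component of [vec X P] normal to the line: it vanishes, and it is the difference between [P]
   and the point with the chosen parameter. *)
assert (e : vscale (cross (vec X P) (vec X Y) / sqd X Y)
    (snd Y - snd X, - (fst Y - fst X)) = (0, 0)).
{ change (cross (vec X P) (vec X Y) = 0) in h; rewrite h.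
  unfold vscale; f_equal; field; lra. }
injection e as e1 e2; destruct P as [P1 P2].
apply injective_projections; coords; apply Rminus_diag_uniq.
- rewrite <- e1; field; lra.
- rewrite <- e2; field; lra.
Qed.

Lemma stewart (s : R) (X P Q : point) :
  sqd X (lerp s P Q) = (1 - s) * sqd X P + s * sqd X Q - s * (1 - s) * sqd P Q.
Proof. coords; ring. Qed.

Lemma cross_trans (x d y : point) :
  d <> (0, 0) -> cross x d = 0 -> cross d y = 0 -> cross x y = 0.
Proof.
destruct d as [d1 d2]; intros ne h1 h2; coords.
assert (h : d1 <> 0 \/ d2 <> 0).
{ destruct (Req_dec d1 0) as [-> | n1]; [|now left].
  right; intros ->; now apply ne. }
destruct h.
- apply (Rmult_eq_reg_r d1); [|assumption].
  transitivity (fst x * (d1 * snd y - d2 * fst y)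
    + fst y * (fst x * d2 - snd x * d1)); [ring | rewrite h1, h2; ring].
- apply (Rmult_eq_reg_r d2); [|assumption].
  transitivity (snd x * (d1 * snd y - d2 * fst y)
    + snd y * (fst x * d2 - snd x * d1)); [ring | rewrite h1, h2; ring].
Qed.

Lemma on_line_cross (P Q : point) (k : line) :
  on_line P k -> on_line Q k -> cross (vec P Q) (dir k) = 0.
Proof. coords; lra. Qed.

(** * Reflections: symmedians, antiparallels and tangent circles *)

Definition reflect_dir (d v : point) : point :=
  vec v (vscale (2 * (dot v d / dot d d)) d).

(** [reflect_dir] is the linear part of the reflection, so the base points drop out. *)
Lemma reflect_line_dir (m k : line) :
  dir (reflect_line m k) = reflect_dir (dir m) (dir k).
Proof.
unfold reflect_line, reflect_point, reflect_dir; coords.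
unfold Rdiv; f_equal; ring.
Qed.

(* The reflection exchanges the unit vectors along the two sides of the angle. *)
Lemma reflect_dir_bisector (X Y Z : point) (s t : R) :
  is_triangle X Y Z ->
  exists c, c <> 0 /\
    reflect_dir (dir (bisector X Y Z))
      (vadd (vscale s (vec Y X)) (vscale t (vec Y Z))) =
    vscale c (vadd (vscale (t * sqd Y Z) (vec Y X))
                   (vscale (s * sqd Y X) (vec Y Z))).
Proof.
intro tri.
assert (nX : Y <> X) by (intro e; apply (triangle_neq X Y Z tri); now symmetry).
assert (nZ : Y <> Z) by (apply (triangle_neq Y Z X); now apply triangle_rot).
pose proof (edist_gt0 _ _ nX) as hx; pose proof (edist_gt0 _ _ nZ) as hz.
pose proof (edist_sqr Y X) as ex; pose proof (edist_sqr Y Z) as ez.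
exists (/ (edist Y X * edist Y Z)); split.
{ apply Rinv_neq_0_compat; nra. }
unfold reflect_dir, bisector, unit_vec.
set (x := edist Y X) in *; set (z := edist Y Z) in *.
set (u := vec Y X); set (v := vec Y Z).
set (q := dot u v).
(* This is [x * z] times 1 plus the cosine of the angle, zero only for a straight angle; [E] is
   Lagrange's identity. *)
assert (hq : x * z + q <> 0).
{ intro e.
  assert (E : q * q + cross u v * cross u v = sqd Y X * sqd Y Z)
    by (unfold q, u, v; coords; ring).
  assert (E2 : cross u v <> 0).
  { intro e'; apply tri; unfold u, v in e'; coords; lra. }
  assert (0 < cross u v * cross u v) by nra.
  assert (q = - (x * z)) by lra; nra. }
assert (hu : dot u u = x * x) by (rewrite ex; reflexivity).
assert (hv : dot v v = z * z) by (rewrite ez; reflexivity).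
set (d := vadd (vscale (/ x) u) (vscale (/ z) v)).
set (y := vadd (vscale s u) (vscale t v)).
assert (dd : dot d d = 2 * (x * z + q) / (x * z)).
{ replace (dot d d) with (/ x * / x * dot u u + 2 * (/ x * / z) * q
    + / z * / z * dot v v) by (unfold d, q; coords; ring).
  rewrite hu, hv; field; lra. }
assert (yd : dot y d = (s * x + t * z) * (x * z + q) / (x * z)).
{ replace (dot y d) with (s * / x * dot u u + (s * / z + t * / x) * q
    + t * / z * dot v v) by (unfold d, y, q; coords; ring).
  rewrite hu, hv; field; lra. }
assert (r : 2 * (dot y d / dot d d) = s * x + t * z).
{ rewrite dd, yd; field; repeat split; lra. }
cbn [dir]; fold u v d y; rewrite r, <- ex, <- ez.
unfold y, d; coords; f_equal; field; lra.
Qed.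

(** The median is directed along the vector sum AB + AC; exchanging the unit vectors of the sides
    turns this into CA^2 AB + AB^2 AC, up to a factor. *)
Lemma symmedian_cross (A B C P : point) :
  is_triangle A B C -> on_line P (symmedian A B C) ->
  cross (vec A P) (vadd (vscale (sqd C A) (vec A B))
                        (vscale (sqd A B) (vec A C))) = 0.
Proof.
intros tri h.
assert (tri' : is_triangle B A C) by (intro e; apply tri; coords; lra).
destruct (reflect_dir_bisector B A C (1 / 2) (1 / 2) tri') as (c & c0 & e).
unfold on_line, symmedian in h; rewrite reflect_line_dir in h.
assert (b : base (reflect_line (bisector B A C)
              (line_through A (midpoint B C))) = A).
{ unfold reflect_line, reflect_point, bisector; destruct A; coords.
  unfold Rdiv; f_equal; ring. }
rewrite b in h.
replace (dir (line_through A (midpoint B C))) with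
  (vadd (vscale (1 / 2) (vec A B)) (vscale (1 / 2) (vec A C))) in h
  by (coords; f_equal; field).
rewrite e, (sqd_sym A C) in h.
apply (Rmult_eq_reg_l (c * / 2)); [|lra].
rewrite Rmult_0_r, <- h; coords; field.
Qed.

(** The conclusion equates the directed products YP YX and YQ YZ. If [k] has coordinates [x], [y] in
    the basis YX, YZ, the reflection being parallel to XZ gives [h2], and PQ being along [k] gives
    [h3]; eliminating [x] and [y] leaves the claim. *)
Lemma antiparallel_fractions (P Q X Y Z : point) (l : line) (s t : R) :
  is_triangle X Y Z -> on_antiparallel P Q l X Y Z ->
  cross (dir l) (vec X Z) = 0 ->
  P = lerp s Y X -> Q = lerp t Y Z -> s * sqd Y X = t * sqd Y Z.
Proof.
intros tri (k & (n1 & n2 & h) & hP & hQ) hl -> ->.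
pose proof (cross_trans _ _ _ n2 h hl) as h'.
rewrite reflect_line_dir in h', n1.
assert (D : cross (vec Y X) (vec Y Z) <> 0).
{ intro e; apply tri; coords; lra. }
destruct k as [b d]; cbn [dir] in *.
set (x := cross d (vec Y Z) / cross (vec Y X) (vec Y Z)).
set (y := cross (vec Y X) d / cross (vec Y X) (vec Y Z)).
assert (ed : d = vadd (vscale x (vec Y X)) (vscale y (vec Y Z))).
{ destruct d; unfold x, y; coords; f_equal; field; lra. }
destruct (reflect_dir_bisector X Y Z x y tri) as (c & c0 & e).
rewrite ed, e in h', n1.
assert (h2 : y * sqd Y Z + x * sqd Y X = 0).
{ apply (Rmult_eq_reg_l (c * cross (vec Y X) (vec Y Z)));
    [|now apply Rmult_integral_contrapositive].
  rewrite Rmult_0_r, <- h'; generalize (sqd Y X) (sqd Y Z); intros.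
  coords; ring. }
assert (h3 : s * y + t * x = 0).
{ pose proof (on_line_cross _ _ _ hP hQ) as h3; cbn [dir] in h3.
  rewrite ed in h3.
  apply (Rmult_eq_reg_l (cross (vec Y X) (vec Y Z))); [|assumption].
  rewrite Rmult_0_r; clearbody x y; coords; lra. }
assert (px : 0 < sqd Y X).
{ apply sqd_gt0; intros ->; apply tri; coords; ring. }
assert (pz : 0 < sqd Y Z).
{ apply sqd_gt0; intros ->; apply tri; coords; ring. }
clearbody x y.
(* If [y] vanished, [h2] would make [x] vanish too, and the reflected line would be degenerate. *)
destruct (Req_dec y 0) as [y0 | y0].
- assert (x = 0) by (subst y; nra); subst x y.
  exfalso; apply n1; coords; f_equal; ring.
- apply (Rmult_eq_reg_l y); [|assumption].
  pose proof (f_equal (Rmult (sqd Y X)) h3).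
  pose proof (f_equal (Rmult t) h2); lra.
Qed.

(** Thales' theorem, including the degenerate case [P = Q = Y]. *)
Lemma parallel_fractions (P Q X Y Z : point) (l : line) (s t : R) :
  is_triangle X Y Z -> on_parallel P Q l -> cross (dir l) (vec X Z) = 0 ->
  P = lerp s Y X -> Q = lerp t Y Z -> s = t.
Proof.
intros tri (k & (n1 & n2 & h) & hP & hQ) hl -> ->.
pose proof (cross_trans _ _ _ n1 (on_line_cross _ _ _ hP hQ)
              (cross_trans _ _ _ n2 h hl)) as h'.
apply (Rmult_eq_reg_r (cross (vec Y X) (vec Y Z))).
- coords; lra.
- intro e; apply tri; coords; lra.
Qed.

(* The reflection of [P] in the line of centers lies on both circles. *)
Lemma tangent_centers (w1 w2 : circle) (P : point) :
  on_circle P w1 -> on_circle P w2 -> tangent_at w1 w2 P ->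
  exists s, center w1 = lerp s P (center w2).
Proof.
intros h1 h2 tan.
assert (h : on_line (center w1) (line_through P (center w2))).
{ destruct (Req_dec (sqd (center w1) (center w2)) 0) as [e | ne].
  { rewrite (sqd_eq0 _ _ e); coords; ring. }
  pose (Q := reflect_point (line_through (center w1) (center w2)) P).
  assert (hQ : Q = P).
  { apply tan; apply on_circleE in h1; apply on_circleE in h2; split;
      apply on_circleE; [rewrite <- h1 | rewrite <- h2];
      unfold Q, reflect_point; coords; field; exact ne. }
  apply (Rmult_eq_reg_l (2 * sqd (center w1) (center w2))); [|lra].
  assert (e : cross (vec P Q) (vec (center w1) (center w2)) = 0)
    by (rewrite hQ; coords; ring).
  (* PQ is normal to the line of centers and twice as long as the distance from [P] to it, so
     [Q = P] puts [P] on that line. *)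
  assert (e1 : cross (vec P Q) (vec (center w1) (center w2)) =
     2 * cross (vec (center w1) (center w2)) (vec (center w1) P)).
  { unfold Q, reflect_point; coords; field; exact ne. }
  assert (e2 : cross (vec (center w1) (center w2)) (vec (center w1) P) = 0)
    by lra.
  assert (e3 : cross (vec P (center w1)) (vec P (center w2)) = 0)
    by (coords; lra).
  change (2 * sqd (center w1) (center w2)
    * cross (vec P (center w1)) (vec P (center w2))
    = 2 * sqd (center w1) (center w2) * 0).
  rewrite e3; ring. }
apply on_lineE in h; [exact h|].
intro e; apply on_circleE in h2; pose proof (radius_gt0 w2).
rewrite e in h2; coords; nra.
Qed.

(** * The Lemoine point as a barycenter *)

Definition bary (a b c : R) (A B C : point) : point :=
  vscale (/ (a + b + c)) (vadd (vscale a A) (vadd (vscale b B) (vscale c C))).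

Lemma lagrange (a b c : R) (X A B C : point) :
  a + b + c <> 0 ->
  sqd X (bary a b c A B C) =
  (a * sqd X A + b * sqd X B + c * sqd X C) / (a + b + c)
  - (b * c * sqd B C + c * a * sqd C A + a * b * sqd A B) / (a + b + c) ^ 2.
Proof. intro h; unfold bary; coords; field; exact h. Qed.

Definition sides_sum (A B C : point) : R := sqd B C + sqd C A + sqd A B.

Definition sides_prod (A B C : point) : R := sqd B C * sqd C A * sqd A B.

Lemma sides_sum_rot (A B C : point) : sides_sum B C A = sides_sum A B C.
Proof. unfold sides_sum; ring. Qed.

Lemma sides_prod_rot (A B C : point) : sides_prod B C A = sides_prod A B C.
Proof. unfold sides_prod; ring. Qed.

Definition lemoine (A B C : point) : point :=
  bary (sqd B C) (sqd C A) (sqd A B) A B C.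

Lemma lemoine_rot (A B C : point) : lemoine B C A = lemoine A B C.
Proof.
unfold lemoine, bary; generalize (sqd A B) (sqd B C) (sqd C A); intros.
replace (r1 + r + r0) with (r0 + r1 + r) by ring.
coords; f_equal; ring.
Qed.

Lemma triangle_sides (A B C : point) :
  is_triangle A B C -> 0 < sqd A B /\ 0 < sqd B C /\ 0 < sqd C A.
Proof.
intro tri; pose proof (triangle_rot _ _ _ tri) as tri1.
pose proof (triangle_rot _ _ _ tri1) as tri2.
repeat split; apply sqd_gt0;
  [apply (triangle_neq A B C) | apply (triangle_neq B C A)
  | apply (triangle_neq C A B)]; assumption.
Qed.

(** The barycenter [L0] lies on the symmedians from [A] and [B]. Their directions [m] and [n] are
    independent, so a nonzero [vec L0 L] cannot be parallel to both. *)
Lemma lemoine_pointE (A B C L : point) :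
  is_triangle A B C -> lemoine_point A B C L -> L = lemoine A B C.
Proof.
intros tri (hA & hB & _).
pose proof (triangle_sides _ _ _ tri) as (p0 & e0 & r0).
apply symmedian_cross in hA; [|exact tri].
apply symmedian_cross in hB; [|now apply triangle_rot].
revert hA hB; unfold lemoine, bary.
set (p := sqd A B) in *; set (e := sqd B C) in *; set (r := sqd C A) in *.
clearbody p e r; intros hA hB.
set (L0 := vscale _ _).
set (m := vadd _ _) in hA; set (n := vadd _ _) in hB.
assert (hA0 : cross (vec A L0) m = 0).
{ unfold L0, m; coords; field; lra. }
assert (hB0 : cross (vec B L0) n = 0).
{ unfold L0, n; coords; field; lra. }
assert (hm : cross (vec L0 L) m = 0) by (clearbody m L0; coords; lra).
assert (hn : cross (vec L0 L) n = 0) by (clearbody n L0; coords; lra).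
assert (mn : cross m n <> 0).
{ replace (cross m n) with
    (p * (e + r + p) * cross (vec A B) (vec A C)) by (unfold m, n; coords; ring).
  repeat apply Rmult_integral_contrapositive_currified; try lra.
  intro z; apply tri; coords; lra. }
destruct (Req_dec (sqd L0 L) 0) as [z | z]; [symmetry; now apply sqd_eq0|].
exfalso; apply mn, (cross_trans _ (vec L0 L)).
- intro z'; apply z; unfold sqd; rewrite z'; unfold dot; cbn; ring.
- clearbody m L0; coords; lra.
- exact hn.
Qed.

(** With the squared sides as weights, each of the three mixed terms in Lagrange's formula equals
    [sides_prod], whence the factor 3. *)
Lemma sqd_lemoine (X A B C : point) :
  is_triangle A B C ->
  sqd X (lemoine A B C) =
  (sqd B C * sqd X A + sqd C A * sqd X B + sqd A B * sqd X C)
    / sides_sum A B C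
  - 3 * sides_prod A B C / sides_sum A B C ^ 2.
Proof.
intro tri; pose proof (triangle_sides _ _ _ tri) as (p0 & e0 & r0).
unfold lemoine; rewrite lagrange by lra.
unfold sides_sum, sides_prod; field; lra.
Qed.

Lemma lemoine_vertex (A B C : point) :
  is_triangle A B C ->
  sqd A (lemoine A B C) = 2 * (sqd A B * sqd C A) / sides_sum A B C
    - 3 * sides_prod A B C / sides_sum A B C ^ 2.
Proof.
intro tri; rewrite sqd_lemoine by exact tri.
rewrite (sqd_sym A C); replace (sqd A A) with 0 by (coords; ring).
unfold Rdiv; ring.
Qed.

(** This identifies the power of the Lemoine point in the circumcircle as minus the subtracted
    term. *)
Lemma lemoine_circumcenter (A B C O : point) (k : R) :
  is_triangle A B C -> sqd A O = k -> sqd B O = k -> sqd C O = k ->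
  sqd O (lemoine A B C) = k - 3 * sides_prod A B C / sides_sum A B C ^ 2.
Proof.
intros tri hA hB hC; pose proof (triangle_sides _ _ _ tri) as (p0 & e0 & r0).
rewrite sqd_lemoine by exact tri.
rewrite (sqd_sym O A), (sqd_sym O B), (sqd_sym O C), hA, hB, hC.
unfold sides_sum; field; lra.
Qed.

(** * Powers of the vertices in the new circle and in the tangent circles *)

(* By Stewart's theorem in triangle [ALO], this is the value for which the power
   of [A] is [AB^2 CA^2 / (2 (AB^2 + BC^2 + CA^2))]. *)
Definition new_radius2 (A B C O : point) : R :=
  9 / 16 * sqd O (lemoine A B C)
  + 3 / 2 * (sides_prod A B C / sides_sum A B C ^ 2).

Definition new_center (A B C O : point) : point :=
  lerp (3 / 4) (lemoine A B C) O.

Lemma new_radius2_rot (A B C O : point) :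
  new_radius2 B C A O = new_radius2 A B C O.
Proof.
unfold new_radius2; now rewrite lemoine_rot, sides_sum_rot, sides_prod_rot.
Qed.

Lemma new_center_rot (A B C O : point) :
  new_center B C A O = new_center A B C O.
Proof. unfold new_center; now rewrite lemoine_rot. Qed.

(* Three rotations are the identity, so the instances have to be listed. *)
Ltac unrotate A B C :=
  rewrite ?(new_center_rot B C A), ?(new_center_rot A B C),
    ?(new_radius2_rot B C A), ?(new_radius2_rot A B C),
    ?(lemoine_rot B C A), ?(lemoine_rot A B C),
    ?(sides_sum_rot B C A), ?(sides_sum_rot A B C),
    ?(sides_prod_rot B C A), ?(sides_prod_rot A B C) in *.

Lemma new_radius2_gt0 (A B C O : point) :
  is_triangle A B C -> 0 < new_radius2 A B C O.
Proof.
intro tri; pose proof (triangle_sides _ _ _ tri) as (p0 & e0 & r0).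
pose proof (sqd_ge0 O (lemoine A B C)).
assert (0 < sides_prod A B C / sides_sum A B C ^ 2).
{ unfold sides_prod, sides_sum; apply Rdiv_lt_0_compat.
  - repeat apply Rmult_lt_0_compat; assumption.
  - apply pow_lt; lra. }
unfold new_radius2; lra.
Qed.

(** In Stewart's formula a quarter of AL^2 supplies the product of sides; the rest cancels by the
    value of the power of the Lemoine point in the circumcircle. *)
Lemma new_circle_power (A B C O : point) (k : R) :
  is_triangle A B C -> sqd A O = k -> sqd B O = k -> sqd C O = k ->
  sqd A (new_center A B C O) =
  new_radius2 A B C O + sqd A B * sqd C A / (2 * sides_sum A B C).
Proof.
intros tri hA hB hC; pose proof (triangle_sides _ _ _ tri) as (p0 & e0 & r0).
unfold new_center, new_radius2; rewrite stewart, hA, lemoine_vertex by exact tri.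
rewrite (sqd_sym (lemoine A B C) O).
rewrite (lemoine_circumcenter A B C O k) by assumption.
unfold sides_prod, sides_sum; field; lra.
Qed.

(** Intersecting chords: the left side is the directed product of LA and LA', hence the power of the
    Lemoine point. *)
Lemma second_intersection (A B C O A' : point) (k m : R) :
  is_triangle A B C -> sqd A O = k -> sqd B O = k -> sqd C O = k ->
  A' = lerp m A (lemoine A B C) -> sqd A' O = k -> A' <> A ->
  (1 - m) * sqd A (lemoine A B C)
    = - (3 * sides_prod A B C / sides_sum A B C ^ 2) /\ m <> 0.
Proof.
intros tri hA hB hC -> hA' ne.
assert (m0 : m <> 0).
{ intros ->; apply ne; destruct A; coords; f_equal; ring. }
split; [|exact m0].
pose proof (lemoine_circumcenter A B C O k tri hA hB hC) as hL.
rewrite sqd_sym, stewart, hL, (sqd_sym O A), hA in hA'.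
apply (Rmult_eq_reg_l m); [lra | exact m0].
Qed.

(** Since [B] lies on [w], its power in [w1] is [1 - s] times BA'^2, where [s] is the ratio of the
    homothety at [A'] taking [w] to [w1]. Both factors are expressed through [m], and [m] through
    the sides. *)
Lemma tangent_circle_power (A B C O A' : point) (w1 w : circle) (m : R) :
  is_triangle A B C -> O = center w ->
  on_circle A w -> on_circle B w -> on_circle C w -> on_circle A' w ->
  A' = lerp m A (lemoine A B C) -> A' <> A ->
  on_circle A' w1 -> on_circle (lemoine A B C) w1 -> tangent_at w1 w A' ->
  sqd B (center w1) =
  radius w1 * radius w1 + sqd A B * sqd B C / (2 * sides_sum A B C).
Proof.
intros tri -> hA hB hC hA' eA' ne h1 hL tan.
pose proof (triangle_sides _ _ _ tri) as (p0 & e0 & r0).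
destruct (tangent_centers _ _ _ h1 hA' tan) as (s & ec).
apply on_circleE in hA, hB, hC, hA', h1, hL.
set (O := center w) in *; set (k := radius w * radius w) in *.
assert (k0 : 0 < k) by (pose proof (radius_gt0 w); unfold k; nra).
destruct (second_intersection A B C O A' k m) as (hm & m0); try assumption.
pose proof (lemoine_circumcenter A B C O k tri hA hB hC) as hOL.
pose proof (lemoine_vertex A B C tri) as hAL.
set (L := lemoine A B C) in *.
set (Q := sides_prod A B C / sides_sum A B C ^ 2).
replace (3 * sides_prod A B C / sides_sum A B C ^ 2) with (3 * Q) in *
  by (unfold Q, Rdiv; ring).
assert (Q0 : 0 < Q).
{ unfold Q, sides_prod, sides_sum; apply Rdiv_lt_0_compat.
  - repeat apply Rmult_lt_0_compat; assumption.
  - apply pow_lt; lra. }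
(* The homothety at [A'] takes [A] to [L]. Here this is extracted from [A'] and [L] being
   equidistant from the center of [w1]. *)
assert (hs : s * m = m - 1).
{ assert (hLA' : sqd L A' = (1 - m) * (1 - m) * sqd A L)
    by (rewrite eA'; clearbody L; coords; ring).
  rewrite ec, stewart in h1.
  rewrite ec, stewart, hLA', (sqd_sym L O), hOL, hA' in hL.
  rewrite hA' in h1; replace (sqd A' A') with 0 in h1 by (coords; ring).
  assert (e1 : (1 - s) * (1 - m) * ((1 - m) * sqd A L) = 3 * Q * s) by lra.
  rewrite hm in e1; apply (Rmult_eq_reg_l (3 * Q)); lra. }
assert (hBL : sqd B L = 2 * (sqd A B * sqd B C) / sides_sum A B C - 3 * Q).
{ pose proof (lemoine_vertex B C A (triangle_rot _ _ _ tri)) as h.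
  unrotate A B C.
  fold L in h; rewrite h; unfold Q, Rdiv; ring. }
assert (hBA' : sqd B A' = m * (2 * (sqd A B * sqd B C) / sides_sum A B C)
    + (1 - m) * sqd A B).
{ rewrite eA', stewart, hBL, (sqd_sym B A).
  transitivity ((1 - m) * sqd A B
    + m * (2 * (sqd A B * sqd B C) / sides_sum A B C - 3 * Q)
    - m * ((1 - m) * sqd A L)); [ring | rewrite hm; ring]. }
(* This is [hm] with AL^2 written in the sides, after cancelling the common factor. *)
assert (hmm : m * (3 * sqd B C) = (m - 1) * (2 * sides_sum A B C)).
{ rewrite hAL in hm.
  assert (e1 : (1 - m) * (2 * (sqd A B * sqd C A) / sides_sum A B C)
    = - (3 * Q) * m) by lra.
  unfold Q, sides_prod in e1.
  assert (S0 : 0 < sides_sum A B C) by (unfold sides_sum; lra).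
  apply (Rmult_eq_reg_l (sqd A B * sqd C A / sides_sum A B C ^ 2)).
  - transitivity (- ((1 - m) * (2 * (sqd A B * sqd C A) / sides_sum A B C)));
      [rewrite e1 |]; field; lra.
  - apply Rgt_not_eq, Rdiv_lt_0_compat; [nra | apply pow_lt; exact S0]. }
rewrite <- h1, ec, !stewart, hB, hA', hBA'.
replace (sqd A' A') with 0 by (coords; ring).
assert (S0 : 0 < sides_sum A B C) by (unfold sides_sum; lra).
apply (Rmult_eq_reg_l m); [|exact m0].
assert (hs' : m * (1 - s) = 1) by lra.
assert (hmm' : (m - 1) * sqd A B
  = m * (3 * (sqd A B * sqd B C) / (2 * sides_sum A B C))).
{ transitivity (m * (3 * sqd B C) * (sqd A B / (2 * sides_sum A B C)));
    [rewrite hmm |]; field; lra. }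
transitivity (m * (1 - s) * (m * (2 * (sqd A B * sqd B C) / sides_sum A B C)
  - (m - 1) * sqd A B) + m * (s * k - s * (1 - s) * k)); [ring|].
rewrite hs', hmm'; field; lra.
Qed.

Lemma triangle_swap (A B C : point) : is_triangle A B C -> is_triangle A C B.
Proof. intros h e; apply h; coords; lra. Qed.

Lemma lemoine_swap (A B C : point) : lemoine A C B = lemoine A B C.
Proof.
unfold lemoine, bary; rewrite (sqd_sym C B), (sqd_sym B A), (sqd_sym A C).
generalize (sqd A B) (sqd B C) (sqd C A); intros.
replace (r0 + r + r1) with (r0 + r1 + r) by ring.
coords; f_equal; ring.
Qed.

(** By Stewart's theorem, the powers of [B] and [C] in a circle determine the power of every point
    of the line BC. The new circle and [w1] agree at [B] and [C], so they cut the line in the same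
    points. *)
Lemma new_circle_side (A B C O L A' P P' : point) (w w1 : circle) :
  is_triangle A B C -> O = center w -> circumcircle A B C w ->
  L = lemoine A B C ->
  on_line A' (line_through A L) /\ on_circle A' w /\ A' <> A ->
  on_circle A' w1 /\ on_circle L w1 /\ tangent_at w1 w A' ->
  meets_line_at w1 (line_through B C) P P' ->
  sqd P (new_center A B C O) = new_radius2 A B C O /\
  sqd P' (new_center A B C O) = new_radius2 A B C O.
Proof.
intros tri eO (hA & hB & hC) -> (hl & hA' & ne) (h1 & hL & tan) meet.
pose proof (triangle_sides _ _ _ tri) as (p0 & e0 & r0).
assert (S0 : 0 < sides_sum A B C) by (unfold sides_sum; lra).
(* Otherwise [A] would be on both [w1] and [w], and tangency would make it [A']. *)
assert (neL : A <> lemoine A B C).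
{ intro e; rewrite <- e in hL; apply ne; symmetry; apply tan; tauto. }
destruct (on_lineE _ _ _ neL hl) as (m & em).
pose proof (tangent_circle_power A B C O A' w1 w m tri eO hA hB hC hA' em ne
              h1 hL tan) as pB.
assert (pC : sqd C (center w1) =
  radius w1 * radius w1 + sqd B C * sqd C A / (2 * sides_sum A B C)).
{ rewrite <- lemoine_swap in em, hL.
  rewrite (tangent_circle_power A C B O A' w1 w m (triangle_swap _ _ _ tri) eO
             hA hC hB hA' em ne h1 hL tan).
  rewrite (sqd_sym A C), (sqd_sym C B).
  unfold sides_sum; rewrite (sqd_sym A C), (sqd_sym C B), (sqd_sym B A).
  unfold sides_sum in S0; field; lra. }
apply on_circleE in hA, hB, hC; rewrite <- eO in hA, hB, hC.
pose proof (triangle_rot _ _ _ tri) as tri1.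
pose proof (triangle_rot _ _ _ tri1) as tri2.
pose proof (new_circle_power B C A O _ tri1 hB hC hA) as qB.
pose proof (new_circle_power C A B O _ tri2 hC hA hB) as qC.
unrotate A B C.
assert (on_side : forall T, T = P \/ T = P' ->
  sqd T (new_center A B C O) = new_radius2 A B C O).
{ intros T hT; apply meet in hT as (hT & hT').
  apply on_lineE in hT' as (s & ->); [|now apply (triangle_neq B C A)].
  apply on_circleE in hT; rewrite sqd_sym, stewart in hT.
  rewrite (sqd_sym _ B), (sqd_sym _ C), pB, pC in hT.
  rewrite sqd_sym, stewart, (sqd_sym _ B), (sqd_sym _ C), qB, qC.
  rewrite (Rmult_comm (sqd B C) (sqd A B)), (Rmult_comm (sqd C A) (sqd B C)).
  lra. }
split; apply on_side; tauto.
Qed.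

(** * Tucker hexagons and the equilateral case *)

(* [T2], [T3] divide [CA], [CB] in the same ratio, and [T4], [T5] divide [AB],
   [AC] in the same ratio.  The power of a point at each of them, divided by the
   square of the side, gives two pairs of quadratic equations in these ratios;
   the difference of the equations of a pair is an equality of two sides. *)
Lemma tucker_equilateral (A B C M : point) (k c : R) (T1 T2 T3 T4 T5 T6 : point) :
  is_triangle A B C -> c <> 0 ->
  sqd A M = k + c * (sqd A B * sqd C A) ->
  sqd B M = k + c * (sqd A B * sqd B C) ->
  sqd C M = k + c * (sqd B C * sqd C A) ->
  tucker_hexagon A B C T1 T2 T3 T4 T5 T6 ->
  sqd T2 M = k -> sqd T3 M = k -> sqd T4 M = k -> sqd T5 M = k ->
  sqd A B = sqd B C /\ sqd C A = sqd B C.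
Proof.
intros tri c0 hA hB hC hex h2 h3 h4 h5.
destruct hex as ((l1 & n1 & _) & (a12 & l2) & (p23 & l3) & (a34 & l4)
                   & (p45 & l5) & _).
pose proof (triangle_sides _ _ _ tri) as (p0 & e0 & r0).
pose proof (triangle_rot _ _ _ tri) as tri1.
pose proof (triangle_rot _ _ _ tri1) as tri2.
pose proof (triangle_neq _ _ _ tri) as nAB.
pose proof (triangle_neq _ _ _ tri1) as nBC.
pose proof (triangle_neq _ _ _ tri2) as nCA.
apply on_lineE in l1 as (s & e1); [|exact nAB].
apply on_lineE in l2 as (t' & e2'); [|exact nCA].
apply on_lineE in l3 as (t3 & e3); [|exact nBC].
apply on_lineE in l4 as (g' & e4'); [|exact nAB].
apply on_lineE in l5 as (h & e5); [|exact nCA].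
(* The fraction lemmas measure from the vertex of the angle, so each of these points is also written
   from the other end of its side. *)
pose proof e2' as e2; rewrite lerp_sym in e2.
pose proof e3 as e3'; rewrite lerp_sym in e3'.
pose proof e4' as e4; rewrite lerp_sym in e4.
pose proof e5 as e5'; rewrite lerp_sym in e5'.
assert (f12 : s * sqd A B = (1 - t') * sqd A C).
{ apply (antiparallel_fractions T1 T2 B A C (line_through B C));
    try assumption.
  - intro z; apply tri; coords; lra.
  - coords; ring. }
assert (f23 : t' = 1 - t3).
{ apply (parallel_fractions T2 T3 A C B (line_through A B)); try assumption.
  - now apply triangle_swap.
  - coords; ring. }
assert (f34 : t3 * sqd B C = (1 - g') * sqd B A).
{ symmetry; apply (antiparallel_fractions T4 T3 A B C (line_through C A));
    try assumption.
  - destruct a34 as (m & ? & ? & ?); exists m; tauto.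
  - coords; ring. }
assert (f45 : g' = 1 - h).
{ apply (parallel_fractions T4 T5 B A C (line_through B C)); try assumption.
  - intro z; apply tri; coords; lra.
  - coords; ring. }
rewrite (sqd_sym A C) in f12; rewrite (sqd_sym B A) in f34.
assert (s0 : s <> 0).
{ intros ->; apply n1; rewrite e1; destruct A; coords; f_equal; ring. }
replace t' with (1 - t3) in * by lra; replace g' with (1 - h) in * by lra.
clear f23 f45.
(* [T1 <> A] propagates along the antiparallels: [f12] amounts to [s] AB^2 = [t3] CA^2, and [f34] to
   [t3] BC^2 = [h] AB^2. *)
assert (t0 : t3 <> 0).
{ intros z; subst t3; apply s0, (Rmult_eq_reg_r (sqd A B)); lra. }
assert (g0 : h <> 0).
{ intros z; subst h; apply t0, (Rmult_eq_reg_r (sqd B C)); lra. }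
rewrite e2', sqd_sym, stewart, (sqd_sym M C), (sqd_sym M A), hA, hC in h2.
rewrite e3, sqd_sym, stewart, (sqd_sym M B), (sqd_sym M C), hB, hC in h3.
rewrite e4', sqd_sym, stewart, (sqd_sym M A), (sqd_sym M B), hA, hB in h4.
rewrite e5, sqd_sym, stewart, (sqd_sym M C), (sqd_sym M A), hA, hC in h5.
clear - h2 h3 h4 h5 p0 e0 r0 c0 t0 g0.
set (p := sqd A B) in *; set (e := sqd B C) in *; set (r := sqd C A) in *.
clearbody p e r.
assert (d2 : c * (t3 * e + (1 - t3) * p) = t3 * (1 - t3))
  by (apply (Rmult_eq_reg_l r); lra).
assert (d3 : c * (t3 * r + (1 - t3) * p) = t3 * (1 - t3))
  by (apply (Rmult_eq_reg_l e); lra).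
assert (d4 : c * (h * r + (1 - h) * e) = h * (1 - h))
  by (apply (Rmult_eq_reg_l p); lra).
assert (d5 : c * (h * p + (1 - h) * e) = h * (1 - h))
  by (apply (Rmult_eq_reg_l r); lra).
assert (er : e = r).
{ apply (Rmult_eq_reg_l (c * t3)); [lra|].
  now apply Rmult_integral_contrapositive. }
assert (pr : p = r).
{ apply (Rmult_eq_reg_l (c * h)); [lra|].
  now apply Rmult_integral_contrapositive. }
lra.
Qed.

(** For equal sides the Lemoine point is also equidistant from the vertices, so LO is orthogonal to
    both AB and AC. *)
Lemma equilateral_center (A B C O : point) (k : R) :
  is_triangle A B C -> sqd A O = k -> sqd B O = k -> sqd C O = k ->
  sqd A B = sqd B C -> sqd C A = sqd B C -> O = lemoine A B C.
Proof.
intros tri hA hB hC e1 e2.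
pose proof (triangle_sides _ _ _ tri) as (p0 & e0 & r0).
set (L := lemoine A B C).
assert (hL : sqd B L = sqd A L /\ sqd C L = sqd A L).
{ pose proof (triangle_rot _ _ _ tri) as tri1.
  pose proof (lemoine_vertex A B C tri) as lA.
  pose proof (lemoine_vertex B C A tri1) as lB.
  pose proof (lemoine_vertex C A B (triangle_rot _ _ _ tri1)) as lC.
  unrotate A B C.
  unfold L; rewrite lA, lB, lC, e1, e2; tauto. }
destruct hL as [lB lC].
assert (d1 : dot (vec L O) (vec A B) = 0)
  by (clearbody L; coords; lra).
assert (d2 : dot (vec L O) (vec A C) = 0)
  by (clearbody L; coords; lra).
assert (D : cross (vec A B) (vec A C) <> 0).
{ intro z; apply tri; coords; lra. }
symmetry; apply sqd_eq0, (Rmult_eq_reg_l (cross (vec A B) (vec A C)));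
  [|exact D].
(* A plane identity expressing LO^2 times the cross product of AB and AC through the two vanishing
   dot products. *)
transitivity (cross (vec L O) (vec A C) * dot (vec L O) (vec A B)
  - cross (vec L O) (vec A B) * dot (vec L O) (vec A C)).
- clearbody L; coords; ring.
- rewrite d1, d2; ring.
Qed.

(** * The circle through the six points *)

Theorem theorem4p1 (A B C O L A' B' C' : point) (w w1 w2 w3 : circle)
    (Ab Ac Bc Ba Ca Cb : point)
    (hABC : is_triangle A B C)
    (hw : circumcircle A B C w)
    (hO : O = center w)
    (hL : lemoine_point A B C L)
    (hA' : on_line A' (line_through A L) /\ on_circle A' w /\ A' <> A)
    (hB' : on_line B' (line_through B L) /\ on_circle B' w /\ B' <> B)
    (hC' : on_line C' (line_through C L) /\ on_circle C' w /\ C' <> C)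
    (hw1 : on_circle A' w1 /\ on_circle L w1 /\ tangent_at w1 w A')
    (hw2 : on_circle B' w2 /\ on_circle L w2 /\ tangent_at w2 w B')
    (hw3 : on_circle C' w3 /\ on_circle L w3 /\ tangent_at w3 w C')
    (hA : meets_line_at w1 (line_through B C) Ab Ac)
    (hB : meets_line_at w2 (line_through C A) Bc Ba)
    (hC : meets_line_at w3 (line_through A B) Ca Cb) :
  exists W : circle,
    (on_circle Ab W /\ on_circle Ac W /\ on_circle Ba W /\
     on_circle Bc W /\ on_circle Ca W /\ on_circle Cb W) /\
    (* For an equilateral triangle O = L, there is no line OL, and W is in fact
       a Tucker circle. *)
    (O <> L -> ~ tucker_circle A B C W) /\
    on_line (center W) (line_through O L) /\
    vec L (center W) = vscale (3 / 4) (vec L O).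
Proof.
apply lemoine_pointE in hL; [|exact hABC].
pose proof hw as (hwA & hwB & hwC).
pose proof (triangle_rot _ _ _ hABC) as tri1.
pose proof (triangle_rot _ _ _ tri1) as tri2.
pose proof (new_radius2_gt0 A B C O hABC) as k0.
assert (kk : sqrt (new_radius2 A B C O) * sqrt (new_radius2 A B C O)
  = new_radius2 A B C O) by (apply sqrt_sqrt; lra).
pose (W := Circle (new_center A B C O) _ (sqrt_lt_R0 _ k0)).
assert (onW : forall P,
  sqd P (new_center A B C O) = new_radius2 A B C O -> on_circle P W).
{ intros P hP; apply on_circleE; cbn; lra. }
(* One side suffices up to rotation: the new center and radius are invariant under cyclic
   relabelling. *)
destruct (new_circle_side A B C O L A' Ab Ac w w1) as [hAb hAc];
  try assumption.
destruct (new_circle_side B C A O L B' Bc Ba w w2) as [hBc hBa];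
  try assumption.
{ unfold circumcircle; tauto. }
{ now unrotate A B C. }
destruct (new_circle_side C A B O L C' Ca Cb w w3) as [hCa hCb];
  try assumption.
{ unfold circumcircle; tauto. }
{ now unrotate A B C. }
unrotate A B C.
exists W; split; [repeat split; now apply onW|].
split; [|split].
- intros ne (T1 & T2 & T3 & T4 & T5 & T6 & hex & h1 & h2 & h3 & h4 & h5 & h6).
  apply ne; rewrite hL.
  apply on_circleE in hwA, hwB, hwC; rewrite <- hO in hwA, hwB, hwC.
  apply on_circleE in h2, h3, h4, h5; cbn in h2, h3, h4, h5.
  rewrite kk in h2, h3, h4, h5.
  pose proof (new_circle_power A B C O _ hABC hwA hwB hwC) as pA.
  pose proof (new_circle_power B C A O _ tri1 hwB hwC hwA) as pB.
  pose proof (new_circle_power C A B O _ tri2 hwC hwA hwB) as pC.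
  unrotate A B C.
  pose proof (triangle_sides _ _ _ hABC) as (p0 & e0 & r0).
  assert (S0 : 0 < sides_sum A B C) by (unfold sides_sum; lra).
  destruct (tucker_equilateral A B C (new_center A B C O) (new_radius2 A B C O)
    (/ (2 * sides_sum A B C)) T1 T2 T3 T4 T5 T6) as [e1 e2]; try assumption.
  { apply Rinv_neq_0_compat; lra. }
  { rewrite pA; field; lra. }
  { rewrite pB; field; lra. }
  { rewrite pC; field; lra. }
  now apply (equilateral_center A B C O (radius w * radius w)).
- cbn; unfold new_center; rewrite <- hL; coords; ring.
- cbn; unfold new_center; rewrite <- hL; coords; f_equal; ring.
Qed.
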